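(* One has \[ \limsup_{n\to\infty} \frac{f(n)}{\log n}\cdot \frac{\log\log\log n}{\log\log n}\geq\frac12 . \] Equivalently, there is a sequence of integers \(n_j\to\infty\) such that \[ f(n_j)\geq\left(\frac12-o(1)\right) \log n_j\,\frac{\log\log n_j}{\log\log\log n_j}\qquad (j\to\infty). \] Consequently, \[ \limsup_{n\to\infty}\frac{f(n)}{\log n}=\infty ; \] equivalently, for every constant \(C>0\) there are arbitrarily large integers \(n\) for which \(f(n)>C\log n\).
   Context: All logarithms are natural. For a prime \(p\) and a positive integer \(m\), \(\nu_p(m)\) denotes the exponent of \(p\) in \(m\). For integers \(n\geq 2\) and \(0\leq k\leq n\), define \[ u(n,k)=\prod_{p\leq k,\ p\text{ prime}}p^{\nu_p\left(\binom nk\right)} \] (the empty product is \(1\)), and \[ f(n)=\min\{1\leq k\leq n: u(n,k)>n^2\}, \] with the convention \(f(n)=+\infty\) if the set is empty. Inequalities and limsups involving \(f\) are understood in the extended reals. *)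

(* Defs.v *)
From mathcomp Require Import all_boot all_order all_algebra.
From mathcomp Require Import all_classical all_reals all_analysis.
Import Order.TTheory GRing.Theory Num.Theory.
Import numFieldNormedType.Exports.

Set Implicit Arguments.
Unset Strict Implicit.
Unset Printing Implicit Defensive.

Definition u (n k : nat) : nat :=
  (\prod_(0 <= p < k.+1 | prime p) p ^ logn p 'C(n, k))%N.

Definition admissible (n k : nat) : bool :=
  [&& 1 <= k, k <= n & n ^ 2 < u n k]%N.

(* The minimum is extended-real valued, with value +oo when no k is admissible;
   the values at n < 2 play no role. *)
Definition f (R : realType) (n : nat) : \bar R :=
  if pselect (exists k, admissible n k) is left exk
  then ((ex_minn exk)%:R)%:E else +oo%E.
Arguments f : clear implicits.

(* Main.v *)
Require Import Defs.
From mathcomp Require Import all_boot all_order all_algebra.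
From mathcomp Require Import all_classical all_reals all_analysis.
From mathcomp Require Import zify ring lra.
Import Order.TTheory GRing.Theory Num.Theory.
Import numFieldNormedType.Exports.

(** Fix a large [K].  The plan is to find [n] with [u n k <= n ^ 2] for every
    [k <= K], so that [f n > K], while keeping [n] as small as
    [exp ((2 + o(1)) * K * ln (ln K) / ln K)]; solving for [K] gives the constant
    [1/2].

    By Kummer's theorem ([logn_bin_borrows]) the exponent of [p] in ['C(n, k)] is the
    number of [j] with [n mod p^j < k mod p^j], that is, of borrows in the
    subtraction [n - k] in base [p].  Borrows are avoided when [n] is slightly
    below a multiple of [p].  To arrange this for all primes up to [K] at once,
    put the integers below [N = K ^ (2 T)] into [Q] classes: the class of [b]
    records [b mod p] up to boxes of width [w ~ K / (8 ln K)] for the primes in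
    [(P, K]], where [P ~ K / (ln K)^2], and records [b] modulo a power of [p]
    exceeding [2 K] for the primes up to [P].  For [b0 < b] in one class,
    [b - b0] is within [w] of a multiple of [p], and the shift
    [n = b - b0 - w] puts all these residues on the favourable side
    ([exists_aligned]).

    The last digit is then cheap: a prime [p > 2 w] with a borrow in its last
    digit divides ['C(k + 2 w, 2 w)] ([borrow_near]), so all such primes
    together contribute at most this binomial, a small power of [n].  A borrow
    at a digit [j >= 2] of a prime [p > P] needs [n mod p^j < K], an event of
    probability about [K / p^j], which is at most [(K / P^2) ^ (j - 1)].  By the
    Chinese remainder theorem and a union bound, there are at most [N / (2 Q)]
    integers below [N] with at least [T] such events as soon as [K ^ T] exceeds
    [Q] by a small margin ([count_many_high_borrows]), so some pair of a class
    with [N / Q] elements avoids them.  The relevant moduli have size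
    [p^2 ~ K^2] while each event saves only a factor [K]; this is why [N] has
    to be about [Q ^ 2], and it is the source of the factor [2].

    Finally [ln Q] is about [d * ln (8 ln K)], where [d] counts the primes in
    [(P, K]].  A limit superior only asks for arbitrarily large [K], and
    [d <= (1 + o(1)) K / ln K] holds for arbitrarily large [K] by an elementary
    argument: if Chebyshev's [theta x] exceeded [(1 + e) x] for all large [x],
    then [n ln n >= ln n! >= \sum_j theta (n / j)] would fail
    ([theta_liminf]).  The class count and the size of [u n k] are compared with
    [K ^ T] in [exists_parameters], and [f_large] translates [K] into [n]. *)

(** * Kummer's theorem: borrows in base p *)

Lemma divn_borrow d n k : 0 < d -> k <= n ->
  n %/ d = k %/ d + (n - k) %/ d + (n %% d < k %% d).
Proof.
move=> d0 kn; rewrite divnB //.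
have h1 : k %/ d + (n %% d < k %% d) <= n %/ d.
  case: (ltnP (n %% d) (k %% d)) => h; last by rewrite addn0 leq_div2r.
  rewrite addn1 ltnNge; apply/negP => h2.
  have : n < k.
    rewrite (divn_eq n d) (divn_eq k d).
    apply: leq_ltn_trans (leq_add (leq_mul h2 (leqnn d)) (leqnn _)) _.
    by rewrite ltn_add2l.
  by rewrite ltnNge kn.
lia.
Qed.

(** Kummer's theorem, from Legendre's formula for the three factorials of
    ['C(n, k)]: the summand of index [j] is the borrow at digit [j]. *)
Lemma logn_bin_borrows p n k : prime p -> k <= n ->
  logn p 'C(n, k) = \sum_(1 <= j < n.+1) (n %% p ^ j < k %% p ^ j).
Proof.
move=> pp kn; have p0 := prime_gt0 pp.
have ext m : m <= n ->
    \sum_(1 <= j < m.+1) m %/ p ^ j = \sum_(1 <= j < n.+1) m %/ p ^ j.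
  move=> mn; rewrite [RHS](big_cat_nat (n := m.+1)) //=.
  rewrite [X in _ = _ + X]big_nat_cond [X in _ = _ + X]big1 ?addn0 //.
  move=> j; rewrite andbT => /andP[hj _]; apply: divn_small.
  by apply: ltn_trans hj _; apply: ltn_expl; apply: prime_gt1.
have := congr1 (logn p) (bin_fact kn).
rewrite !lognM ?muln_gt0 ?bin_gt0 ?fact_gt0 ?kn //.
rewrite !logn_fact // (ext k) // (ext (n - k)) ?leq_subr // -big_split /=.
rewrite [X in _ = X -> _](eq_bigr (fun j => k %/ p ^ j + (n - k) %/ p ^ j +
   (n %% p ^ j < k %% p ^ j))); last first.
  by move=> j _; apply: divn_borrow; rewrite ?expn_gt0 ?p0.
by rewrite [X in _ = X -> _]big_split /= => /eqP; rewrite addnC eqn_add2l => /eqP.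
Qed.

(** Upper bound, uniform in [k <= K], for the number of borrows beyond the last
    digit: a borrow at digit [j] forces [n mod p^j < k mod p^j <= K]. *)
Definition high_borrows K p n := \sum_(2 <= j < n.+1) (n %% p ^ j < K).

Lemma leq_modn_exp p n i j : i <= j -> n %% p ^ i <= n %% p ^ j.
Proof.
move=> ij; rewrite -(@modn_dvdm (p ^ j) n (p ^ i)) ?dvdn_exp2l //.
exact: leq_mod.
Qed.

(** The condition [n mod p^j < K] is inherited by smaller [j], so the indices
    counted by [high_borrows] form an initial segment [2, ..., t + 1]. *)
Lemma high_borrows_modn K p n t : 0 < t -> t <= high_borrows K p n -> n %% p ^ t.+1 < K.
Proof.
move=> t0 th; rewrite ltnNge; apply/negP => hK.
suff : high_borrows K p n <= t.-1 by lia.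
have tail j : t < j -> (n %% p ^ j < K) = false.
  by move=> tj; apply/negbTE; rewrite -leqNgt (leq_trans hK) // leq_modn_exp.
rewrite /high_borrows.
have [tn|nt] := leqP t n; last first.
  apply: (@leq_trans (\sum_(2 <= j < n.+1) 1)); last by rewrite sum_nat_const_nat; lia.
  by apply: leq_sum => j _; apply: leq_b1.
rewrite (big_cat_nat (n := t.+1)) //= [X in _ + X]big_nat_cond [X in _ + X]big1 ?addn0.
  apply: (@leq_trans (\sum_(2 <= j < t.+1) 1)); last by rewrite sum_nat_const_nat; lia.
  by apply: leq_sum => j _; apply: leq_b1.
by move=> j; rewrite andbT => /andP[hj _]; rewrite tail.
Qed.

(** * Products of primes and the primorial *)

Lemma prime_dvd_fact_leq p m : prime p -> p %| m`! -> p <= m.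
Proof.
move=> pp; elim: m => [|m IH]; first by rewrite dvdn1 => /eqP E; rewrite E in pp.
rewrite factS Euclid_dvdM // => /orP[/dvdn_leq -> //|/IH]; exact: leqW.
Qed.

Lemma prod_prime_powers_dvdn (s : seq nat) (e : nat -> nat) m : uniq s ->
  (forall p, p \in s -> prime p /\ p ^ e p %| m) -> \prod_(p <- s) p ^ e p %| m.
Proof.
elim: s => [|p s IH] /=; first by rewrite big_nil.
case/andP => ps us H; have [pp pm] := H p (mem_head _ _).
have {}H q : q \in s -> prime q /\ q ^ e q %| m by move=> qs; apply: H; rewrite inE qs orbT.
rewrite big_cons Gauss_dvd ?pm ?IH //; apply: coprimeXl.
rewrite prime_coprime // Euclid_dvd_prod // big_has; apply/hasPn => q qs /=.
have [pq _] := H q qs.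
rewrite Euclid_dvdX // dvdn_prime2 // negb_and; apply/orP; left.
by apply: contraNneq ps => ->.
Qed.

Lemma prod_primes_dvdn (s : seq nat) m : uniq s ->
  (forall p, p \in s -> prime p /\ p %| m) -> \prod_(p <- s) p %| m.
Proof. exact: (@prod_prime_powers_dvdn s (fun=> 1)). Qed.

Definition primorial n := \prod_(0 <= p < n.+1 | prime p) p.

(** The two equal middle coefficients of row [2m + 1] add up to at most the sum
    [2 ^ (2m + 1)] of the whole row. *)
Lemma bin_middle_le m : 'C(m.*2.+1, m) <= 4 ^ m.
Proof.
have h : 2 * 'C(m.*2.+1, m) <= 2 ^ m.*2.+1.
  rewrite (_ : 2 ^ m.*2.+1 = \sum_(i < m.*2.+2) 'C(m.*2.+1, i)); last first.
    by rewrite -[2]/(1 + 1) expnDn; apply: eq_bigr => i _; rewrite !exp1n !muln1.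
  rewrite -(big_mkord xpredT (fun i => 'C(m.*2.+1, i))).
  rewrite (big_cat_nat (n := m)) //=; last by lia.
  rewrite [X in _ + X](big_cat_nat (n := m.+2)) //=; [|lia|lia].
  rewrite big_nat_recr /=; last lia.
  rewrite big_nat1.
  have -> : 'C(m.*2.+1, m.+1) = 'C(m.*2.+1, m).
    by rewrite -[in RHS]bin_sub; [congr 'C(_, _)|]; lia.
  lia.
rewrite -(leq_pmul2l (isT : 0 < 2)); apply: leq_trans h _.
by rewrite expnS -mul2n expnM.
Qed.

(** Erdős' induction: an even [n > 2] adds no prime, and for [n = 2m + 1] the
    primes in [(m + 1, 2m + 1]] all divide ['C(2m + 1, m) <= 4 ^ m]. *)
Lemma primorial_le n : primorial n <= 4 ^ n.
Proof.
have [N] := ubnP n; elim: N n => // N IH n; rewrite ltnS => nN.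
have [n2|n2] := leqP n 2.
  by case: n n2 {nN} => [|[|[|n]]] // _; rewrite /primorial unlock.
have [on|en] := boolP (odd n); last first.
  rewrite /primorial big_mkcond big_nat_recr //= -big_mkcond /=.
  have -> : prime n = false.
    apply/negbTE/negP => /even_prime[] => [E|]; last exact/negP.
    by rewrite E in n2.
  rewrite muln1 -/(primorial n.-1).
  have -> : n = n.-1.+1 by lia.
  apply: leq_trans (IH n.-1 _) _; first lia.
  by rewrite leq_exp2l.
have nE : n = n./2.*2.+1 by rewrite -[LHS]odd_double_half on.
set m := n./2 in nE.
rewrite /primorial (big_cat_nat (n := m.+2)) //=; last lia.
have -> : 4 ^ n = 4 ^ m.+1 * 4 ^ m by rewrite -expnD nE; congr (_ ^ _); lia.
apply: leq_mul; first by apply: (IH m.+1); lia.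
apply: leq_trans (bin_middle_le m).
rewrite -big_filter; apply: dvdn_leq; first by rewrite bin_gt0; lia.
apply: prod_primes_dvdn; first by rewrite filter_uniq // iota_uniq.
move=> p; rewrite mem_filter mem_index_iota => /andP[pp hp]; split => //.
have : p %| n`! by apply: dvdn_fact; rewrite prime_gt0 //=; lia.
rewrite [in n`!]nE -(@bin_fact m.*2.+1 m); last lia.
rewrite !Euclid_dvdM // -nE => /or3P[//|/(prime_dvd_fact_leq _ _ pp)|/(prime_dvd_fact_leq _ _ pp)]; lia.
Qed.

(** * Counting integers with prescribed small residues *)

Lemma leq_expl m n e : m <= n -> m ^ e <= n ^ e.
Proof. by case: e => // e; rewrite leq_exp2r. Qed.

Lemma leq_count_inj (A B : eqType) (P : pred A) (s : seq A) (r : seq B) (g : A -> B) :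
  uniq s -> {in [seq x <- s | P x] &, injective g} ->
  (forall x, x \in s -> P x -> g x \in r) -> count P s <= size r.
Proof.
move=> us ig gr; rewrite -size_filter -(size_map g); apply: uniq_leq_size.
  by rewrite map_inj_in_uniq ?filter_uniq.
move=> _ /mapP[x + ->]; rewrite mem_filter => /andP[Px xs]; exact: gr.
Qed.

Section Residues.
Variables (I : eqType) (q c : I -> nat).

Let ok (s : seq I) n := all (fun i => n %% q i < c i) s.

Lemma modn_prod s i n : i \in s -> n %% (\prod_(j <- s) q j) %% q i = n %% q i.
Proof. by move=> si; rewrite modn_dvdm // (big_rem _ si) /= dvdn_mulr. Qed.

Lemma ok_mod s n : ok s (n %% \prod_(j <- s) q j) = ok s n.
Proof. by apply: eq_in_all => i si; rewrite modn_prod. Qed.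

(** Chinese remainder theorem as an inequality: on one period the residues
    determine the integer, so there are at most as many integers as tuples of
    admissible residues. *)
Lemma count_residues_period (s : seq I) :
  {in s, forall i, 0 < q i} -> pairwise (fun i j => coprime (q i) (q j)) s ->
  count (ok s) (iota 0 (\prod_(i <- s) q i)) <= \prod_(i <- s) c i.
Proof.
elim: s => [|i s IH]; first by rewrite !big_nil.
move=> q0 /= /andP[ci cs].
have qi : 0 < q i by apply: q0; rewrite inE eqxx.
have {}IH := IH (fun j sj => q0 j (mem_behead (s := i :: s) sj)) cs.
rewrite !big_cons; set D := \prod_(j <- s) q j in IH *.
have cD : coprime (q i) D.
  rewrite /D; elim: (s) ci => [|j r IHr]; first by rewrite big_nil coprimen1.
  by rewrite big_cons coprimeMr /= => /andP[-> /IHr ->].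
apply: leq_trans (leq_mul (leqnn (c i)) IH).
rewrite -(size_filter (ok s)) -[c i](size_iota 0) -(size_allpairs pair).
apply: (@leq_count_inj _ _ _ _ _ (fun n => (n %% q i, n %% D))).
- exact: iota_uniq.
- move=> x y; rewrite !mem_filter !mem_iota /= => /andP[_ hx] /andP[_ hy] [ex ey].
  apply/eqP; rewrite -(modn_small hx) -(modn_small hy) chinese_remainder //.
  by rewrite ex ey !eqxx.
move=> x; rewrite mem_iota /= => hx /andP[xi xs].
apply/allpairsP; exists (x %% q i, x %% D); split => //=; first by rewrite mem_iota.
rewrite mem_filter ok_mod mem_iota /= [ok s x]xs /=.
by apply: ltn_pmod; move: hx; rewrite /D; case: (\prod_(j <- s) q j) => //; rewrite muln0.
Qed.

Lemma count_residues (s : seq I) N :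
  {in s, forall i, 0 < q i} -> pairwise (fun i j => coprime (q i) (q j)) s ->
  count (ok s) (iota 0 N) <=
    (N %/ \prod_(i <- s) q i).+1 * \prod_(i <- s) c i.
Proof.
move=> q0 cs; set D := \prod_(i <- s) q i.
have D0 : 0 < D by rewrite /D big_seq prodn_cond_gt0.
apply: leq_trans (leq_mul (leqnn _) (count_residues_period s q0 cs)).
rewrite -(size_filter (ok s) (iota 0 D)) -[(_ %/ _).+1](size_iota 0) -(size_allpairs pair).
apply: (@leq_count_inj _ _ _ _ _ (fun n => (n %/ D, n %% D))).
- exact: iota_uniq.
- move=> x y _ _ [ex ey]; by rewrite (divn_eq x D) (divn_eq y D) ex ey.
move=> x; rewrite mem_iota => /andP[_ hx] xs.
apply/allpairsP; exists (x %/ D, x %% D); split => //.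
  by rewrite mem_iota ltnS leq_div2r // ltnW.
by rewrite mem_filter ok_mod [ok s x]xs mem_iota /= ltn_pmod.
Qed.

End Residues.

(** Used to lower the numbers of high borrows of the primes to exponents of
    total exactly [T], which keeps the union bound over exponents small. *)
Lemma sumn_truncate (es : seq nat) T : T <= sumn es ->
  exists ts, [/\ size ts = size es, sumn ts = T &
    forall i, nth 0 ts i <= nth 0 es i].
Proof.
elim: es T => [|e es IH] T /=.
  by rewrite leqn0 => /eqP ->; exists [::]; split => // i; rewrite nth_nil.
move=> H; have [ts [hs ht hn]] := IH (T - minn T e) ltac:(lia).
exists (minn T e :: ts); split => /=; [by rewrite hs|lia|].
by case=> [|i] /=; [exact: geq_minr|].
Qed.

Section HighBorrows.
Variables (K P T N : nat) (s : seq nat).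
Hypotheses (P0 : 0 < P) (PK : P <= K) (us : uniq s)
  (sp : {in s, forall p, [/\ prime p, P < p & p <= K]}) (NK : K ^ (2 * T) <= N).

Let q (t : seq nat) i := if nth 0 t i == 0 then 1 else nth 0 s i ^ (nth 0 t i).+1.
Let c (t : seq nat) i := if nth 0 t i == 0 then 1 else K.
Let ok t n := all (fun i => n %% q t i < c t i) (iota 0 (size s)).

(** A fixed pattern [t] of exponents asks for [n mod p^(t_p + 1) < K] at every
    prime [p] with [t_p > 0].  The product of the moduli is at most
    [K ^ (2 T) <= N], so such [n] have density at most twice the product of the
    [K / p^(t_p + 1)], and each of these is at most [(K / P^2) ^ t_p]. *)
Lemma count_exponent_pattern (t : seq nat) : size t = size s -> sumn t = T ->
  count (ok t) (iota 0 N) * P ^ (2 * T) <= 2 * N * K ^ T.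
Proof.
move=> st Tt.
have nthp i : i \in iota 0 (size s) -> [/\ prime (nth 0 s i), P < nth 0 s i & nth 0 s i <= K].
  by rewrite mem_iota /= => hi; apply: sp; rewrite mem_nth.
have TE : T = \sum_(i <- iota 0 (size s)) nth 0 t i.
  by rewrite -Tt sumnE -{1}(mkseq_nth 0 t) big_map st.
have q0 : {in iota 0 (size s), forall i, 0 < q t i}.
  move=> i hi; rewrite /q; case: ifP => // _; rewrite expn_gt0.
  by case: (nthp i hi) => /prime_gt0 ->.
have cop : pairwise (fun i j => coprime (q t i) (q t j)) (iota 0 (size s)).
  have : pairwise (fun i j => i != j) (iota 0 (size s)) by rewrite -uniq_pairwise iota_uniq.
  apply: (sub_in_pairwise (P := fun i => i \in iota 0 (size s))); last by apply/allP.
  move=> i j hi hj ij; rewrite /q.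
  case: ifP => [_|_]; first exact: coprime1n.
  case: ifP => [_|_]; first exact: coprimen1.
  apply: coprimeXl; apply: coprimeXr.
  have [pi _ _] := nthp i hi; have [pj _ _] := nthp j hj.
  rewrite prime_coprime // dvdn_prime2 // nth_uniq //.
    by move: hi; rewrite /= mem_iota.
  by move: hj; rewrite /= mem_iota.
have Hc := @count_residues _ (q t) (c t) _ N q0 cop.
set D := \prod_(i <- _) q t i in Hc.
set C := \prod_(i <- _) c t i in Hc.
have D0 : 0 < D by rewrite /D big_seq prodn_cond_gt0.
have DN : D <= N.
  apply: leq_trans NK; rewrite TE big_distrr /= expn_sum /D.
  rewrite big_seq [X in _ <= X]big_seq; apply: leq_prod => i hi.
  have [_ _ hK] := nthp i hi; rewrite /q; case: ifP => [/eqP ->|t0] //.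
  apply: leq_trans (leq_pexp2l _ _); last first.
  - by instantiate (1 := (nth 0 t i).+1); lia.
  - lia.
  - by rewrite leq_exp2r.
have DC : P ^ (2 * T) * C <= D * K ^ T.
  rewrite {1 2}TE big_distrr /= !expn_sum /D /C -!big_split /=.
  rewrite big_seq [X in _ <= X]big_seq; apply: leq_prod => i hi.
  have [_ hP _] := nthp i hi; rewrite /q /c; case: eqP => [->|t0] //.
  case: (nth 0 t i) t0 => // j _.
  (* the exponent of p is t + 1 = j + 2, so 2 t = (j + 2) + j; the last j factors P are traded against K *)
  rewrite (_ : 2 * j.+1 = j.+2 + j); last lia.
  rewrite expnD -mulnA leq_mul //; first by rewrite leq_exp2r // ltnW.
  by rewrite expnSr leq_mul // leq_expl.
rewrite -(leq_pmul2l D0).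
apply: (@leq_trans (D * ((N %/ D).+1 * C) * P ^ (2 * T))).
  by rewrite mulnA leq_mul // leq_mul.
apply: (@leq_trans ((2 * N) * (P ^ (2 * T) * C))).
  rewrite !mulnA (mulnAC _ C) leq_mul // leq_mul //.
  by rewrite mulnC mulSn addnC mul2n -addnn leq_add // leq_divM.
by rewrite (mulnC D) -[X in _ <= X]mulnA leq_mul // [K ^ T * D]mulnC.
Qed.

(** Union bound over the exponent patterns of total [T]; there are at most
    ['C(size s + T, T)] of them. *)
Lemma count_many_high_borrows :
  count (fun n => T <= \sum_(p <- s) high_borrows K p n) (iota 0 N) * P ^ (2 * T)
    <= 'C(size s + T, T) * (2 * N * K ^ T).
Proof.
pose A := [set t : (size s).-tuple 'I_T.+1 | \sum_(i <- t) i == T :> nat].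
have cA : #|A| <= 'C(size s + T, T).
  have -> : 'C(size s + T, T) = 'C(size s + T, size s).
    by rewrite -bin_sub ?leq_addl // addnK.
  rewrite -card_partial_ord_partitions; apply: subset_leq_card.
  by apply/fintype.subsetP => t; rewrite !inE => /eqP ->.
pose v (t : (size s).-tuple 'I_T.+1) := [seq val i | i <- t].
have vs t : size (v t) = size s by rewrite size_map size_tuple.
have Hcov n : (T <= \sum_(p <- s) high_borrows K p n) <= \sum_(t in A) ok (v t) n.
  case: (leqP T) => [H|//]; move: H.
  rewrite -(big_map (fun p => high_borrows K p n) xpredT id) /= -sumnE.
  move=> /sumn_truncate[ts [h1 h2 h3]]; rewrite size_map in h1.
  have hts : size (map (inord (n' := T)) ts) == size s by rewrite size_map h1.
  have vE : v (Tuple hts) = ts.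
    rewrite /v /= -map_comp -[RHS]map_id; apply/eq_in_map => x xs /=.
    by rewrite inordK // ltnS -h2 sumnE (big_rem _ xs) leq_addr.
  have tA : Tuple hts \in A.
    by rewrite inE -(big_map val xpredT id) -/(v _) vE -sumnE h2.
  rewrite (bigD1 _ tA) /= vE; suff -> : ok ts n by [].
  apply/allP => i; rewrite mem_iota /= => hi; rewrite /q /c.
  case: ifP => [_|/negbT t0]; first by rewrite modn1.
  apply: high_borrows_modn; first by rewrite lt0n.
  by apply: leq_trans (h3 i) _; rewrite (nth_map 0).
apply: (@leq_trans (\sum_(t in A) count (ok (v t)) (iota 0 N) * P ^ (2 * T))).
  rewrite -big_distrl /= leq_mul //.
  rewrite -!sum1_count big_mkcond /=.
  rewrite (eq_bigr (fun t => \sum_(n <- iota 0 N) ok (v t) n)); last first.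
    by move=> t _; rewrite -sum1_count big_mkcond.
  rewrite exchange_big /=; apply: leq_sum => n _; apply: leq_trans (Hcov n).
  by case: ifP.
apply: (@leq_trans (\sum_(t in A) 2 * N * K ^ T)); last first.
  by rewrite sum_nat_const leq_mul.
apply: leq_sum => t; rewrite inE => /eqP tT; apply: count_exponent_pattern => //.
by rewrite sumnE /v big_map.
Qed.
End HighBorrows.

(** * Choosing n by the pigeonhole principle *)

(** Refining by one key after the other and keeping a largest fibre each
    time. *)
Lemma pigeonhole (T : finType) (I : eqType) (s : seq I) (key : I -> T -> nat)
    (c : I -> nat) (A : {set T}) :
  (forall i x, i \in s -> key i x < c i) ->
  exists B : {set T}, [/\ B \subset A, #|A| <= #|B| * \prod_(i <- s) c i &
    forall i x y, i \in s -> x \in B -> y \in B -> key i x = key i y].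
Proof.
elim: s => [|i s IH] kc; first by exists A; rewrite big_nil muln1.
have {IH}[j x js|B [BA AB kB]] := IH; first by apply: kc; rewrite inE js orbT.
pose F (r : 'I_(c i)) := [set x in B | key i x == r :> nat].
have sF : #|B| = \sum_r #|F r|.
  transitivity (\sum_(x in B) \sum_(r : 'I_(c i)) (key i x == r :> nat)).
    rewrite -sum1_card; apply: eq_bigr => x xB.
    have ki : key i x < c i by apply: kc; rewrite mem_head.
    rewrite (bigD1 (Ordinal ki)) //= eqxx big1 ?addn0 // => r.
    by rewrite -val_eqE /= eq_sym => /negbTE ->.
  rewrite exchange_big; apply: eq_bigr => r _.
  by rewrite -sum1_card big_mkcond [RHS]big_mkcond /=; apply: eq_bigr => x _; rewrite inE; case: (x \in B).
have [/eqP B0|Bn] := boolP (B == finset.set0).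
  exists finset.set0; split; first exact: finset.sub0set.
    by move: AB; rewrite B0 cards0 !mul0n.
  by move=> j y z _; rewrite inE.
have [x xB] := finset.set0Pn _ Bn.
have ki : key i x < c i by apply: kc; rewrite mem_head.
case: (@arg_maxnP _ (Ordinal ki) xpredT (fun r => #|F r|)) => // r _ rmax.
exists (F r); split.
- by apply: fintype.subset_trans BA; apply/fintype.subsetP => y; rewrite inE => /andP[].
- rewrite big_cons mulnA; apply: leq_trans AB _; rewrite leq_mul //.
  rewrite sF mulnC; apply: (@leq_trans (\sum_(j : 'I_(c i)) #|F r|)).
    by apply: leq_sum => j _; apply: rmax.
  by rewrite sum_nat_const card_ord.
move=> j y z; rewrite inE => /orP[/eqP ->|js].
  by rewrite !inE => /andP[_ /eqP ->] /andP[_ /eqP ->].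
by rewrite !inE => /andP[yB _] /andP[zB _]; apply: kB.
Qed.

(** Pair every element of [B] with its minimum [b0].  The differences are
    distinct, so at most [Y] of them are below [Y] and at most
    [count bad (iota 0 N)] of them are bad after the shift by [w]. *)
Lemma exists_far_good (N Y w : nat) (bad : pred nat) (B : {set 'I_N}) :
  w <= Y -> Y + count bad (iota 0 N) < #|B| ->
  exists b0 b : 'I_N, [/\ b0 \in B, b \in B, b0 + Y <= b & ~~ bad (b - b0 - w)].
Proof.
move=> wY H.
have [b1 b1B] : exists b1, b1 \in B by apply/finset.set0Pn; rewrite -card_gt0; lia.
case: (@arg_minnP _ b1 (mem B) val) => // b0 b0B bmin.
case: (boolP [exists b in B, (b0 + Y <= b) && ~~ bad (b - b0 - w)]).
  by case/existsP => b /and3P[bB h1 h2]; exists b0, b.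
move=> /existsPn Hn; exfalso; move: H; apply/negP; rewrite -leqNgt.
rewrite cardE -(count_predT).
(* an injection of B into the disjoint union of [0, Y) and the bad integers *)
pose g (b : 'I_N) := if b < b0 + Y then b - b0 else Y + (b - b0 - w).
pose r := iota 0 Y ++ [seq Y + i | i <- [seq i <- iota 0 N | bad i]].
have -> : Y + count bad (iota 0 N) = size r.
  by rewrite size_cat size_iota size_map size_filter.
apply: (@leq_count_inj _ _ _ _ _ g).
- exact: enum_uniq.
- rewrite filter_predT => x y; rewrite !mem_enum => /bmin hx /bmin hy; rewrite /g => E.
  have {}hx : b0 <= x := hx; have {}hy : b0 <= y := hy.
  apply: ord_inj; move: E; case: ltnP => ?; case: ltnP => ?; lia.
move=> x; rewrite mem_enum => xB _; rewrite mem_cat mem_iota /= /g.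
have hx : b0 <= x := bmin x xB; move: (Hn x); rewrite xB /=.
case: (ltnP x (b0 + Y)) => hY /=.
  by move=> _; apply/orP; left; rewrite add0n; lia.
rewrite negbK => hb; apply/orP; right; apply/mapP; exists (x - b0 - w) => //.
by rewrite mem_filter hb mem_iota /=; have := ltn_ord x; lia.
Qed.

Definition primes_in P K := [seq p <- index_iota P.+1 K.+1 | prime p].

Lemma mem_primes_in P K p : (p \in primes_in P K) = [&& prime p, P < p & p <= K].
Proof. by rewrite mem_filter mem_index_iota. Qed.

Lemma same_residue_dvdn M b0 b w : b0 + w <= b -> b0 %% M = b %% M ->
  M %| b - b0 - w + w.
Proof.
move=> hb /esym/eqP; rewrite subnK; last by rewrite leq_subRL; lia.
by rewrite eqn_mod_dvd //; lia.
Qed.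

(** Two residues in one box of width [w] differ by less than [w], so after the
    shift by [w] the number lies in the window of length [2 w] just below a
    multiple of [p]. *)
Lemma same_box_near p b0 b w : 0 < p -> 0 < w -> b0 + w <= b ->
  (b0 %% p) %/ w = (b %% p) %/ w ->
  exists2 y, p %| b - b0 - w + y & 0 < y < 2 * w.
Proof.
move=> p0 w0 hb E.
have f1 := divn_eq (b %% p) w; have f0 := divn_eq (b0 %% p) w.
have := ltn_pmod (b %% p) w0; have := ltn_pmod (b0 %% p) w0.
rewrite -E in f1; set r := _ %/ w * w in f1 f0.
set x := b %% p %% w in f1 *; set x0 := b0 %% p %% w in f0 *.
have e1 := divn_eq b p; have e0 := divn_eq b0 p.
(* x and x0 are the positions inside the common box *)
move=> hx0 hx; exists (w + x0 - x); last lia.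
have -> : b - b0 - w + (w + x0 - x) = (b %/ p - b0 %/ p) * p.
  rewrite mulnBl; lia.
exact: dvdn_mull.
Qed.

Lemma prod_primes_split (F : nat -> nat) (P K a c d : nat) : P <= K ->
  d = size (primes_in P K) -> 0 < a ->
  (forall p, p <= P -> F p = a) -> (forall p, P < p -> F p = c) ->
  \prod_(p <- iota 0 K.+1 | prime p) F p <= a ^ P * c ^ d.
Proof.
move=> PK -> a0 Fa Fc.
rewrite -[iota 0 K.+1]/(index_iota 0 K.+1).
rewrite (big_cat_nat (n := P.+1)) //=; apply: leq_mul.
  apply: (@leq_trans (\prod_(1 <= p < P.+1) a)); last first.
    by rewrite prod_nat_const_nat subn1.
  rewrite big_ltn_cond //= [X in _ <= X]big_nat big_nat_cond big_mkcondr /=.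
  apply: leq_prod => p /andP[_ hp]; case: ifP => // _; by rewrite Fa.
rewrite -big_filter -/(primes_in P K) big_seq.
rewrite (eq_bigr (fun _ => c)); last first.
  by move=> p; rewrite mem_primes_in => /and3P[_ hp _]; rewrite Fc.
by rewrite -big_seq big_const_seq count_predT iter_muln_1.
Qed.

(** To be read with [Q] classes, [m] bad integers, a class of size [sz],
    [k = K ^ T], [p = P ^ (2 T)] and [C] exponent patterns: [w + k] and [m] are
    both at most [N / (2 Q)], the first one strictly, and [sz >= N / Q]. *)
Lemma class_beats_bad (N Q C k p w m sz : nat) :
  0 < Q -> 0 < C -> w < k -> p <= N ->
  4 * Q * C * k <= p -> m * p <= C * (2 * N * k) -> N <= sz * Q ->
  w + k + m < sz.
Proof.
move=> Q0 C0 wk pN H cbad h3.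
have k0 : 0 < k by apply: leq_ltn_trans wk.
have h1 : 2 * Q * m <= N.
  have D0 : 0 < 2 * C * k by rewrite !muln_gt0 C0 k0.
  rewrite -(leq_pmul2r D0).
  rewrite (_ : 2 * Q * m * _ = m * (4 * Q * C * k)); last by ring.
  apply: leq_trans (leq_mul (leqnn m) H) _; apply: leq_trans cbad _.
  by apply/eq_leq; ring.
have h2 : 2 * Q * (w + k) < N.
  apply: leq_trans pN; apply: leq_trans H.
  apply: (@leq_trans (4 * Q * k)).
    rewrite (_ : 4 * Q * k = 2 * Q * (k + k)); last by ring.
    by rewrite ltn_pmul2l ?muln_gt0 ?ltn_add2r.
  by rewrite [leqRHS]mulnAC leq_pmulr.
rewrite -(ltn_pmul2r Q0); apply: leq_trans h3.
rewrite -(ltn_pmul2l (isT : 0 < 2)) mulnDl mulnDr !(mulnC _ Q) !mulnA.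
by rewrite [X in _ < X]mul2n -addnn -addSn leq_add.
Qed.

(** With [d] primes in [(P, K]], the first factor bounds the number of classes:
    at most [2 K ^ 2] residues for each prime up to [P] and [K %/ w + 1] boxes for
    each other prime.  The inequality makes bad integers rarer than a class. *)
Definition class_budget K w P T d :=
  4 * ((2 * K ^ 2) ^ P * (K %/ w).+1 ^ d) * 'C(d + T, T) * K ^ T <= P ^ (2 * T).

(** Existence of an [n] that is just below a multiple of every prime up to [K]
    and has few high borrows.  The bound [K ^ T <= n] is part of the conclusion
    because [u n k] has to be compared with [n ^ 2] in the end. *)
Lemma exists_aligned K w P T (d := size (primes_in P K)) :
  0 < w -> w < K -> 0 < P -> P <= K -> 0 < T -> class_budget K w P T d ->
  exists n, [/\ K ^ T <= n, n < K ^ (2 * T),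
    forall p, prime p -> p <= P ->
       p ^ (trunc_log p (2 * K)).+1 %| n + w,
    forall p, p \in primes_in P K -> exists2 y, p %| n + y & 0 < y < 2 * w &
    \sum_(p <- primes_in P K) high_borrows K p n < T].
Proof.
move=> w0 wK P0 PK T0 H.
have K1 : 1 < K by lia.
pose N := K ^ (2 * T).
pose M p := p ^ (trunc_log p (2 * K)).+1.
pose key (p b : nat) := if p <= P then b %% M p else (b %% p) %/ w.
pose c p := if p <= P then 2 * K ^ 2 else (K %/ w).+1.
pose s := [seq p <- iota 0 K.+1 | prime p].
pose Q := (2 * K ^ 2) ^ P * (K %/ w).+1 ^ d.
have sc : \prod_(p <- s) c p <= Q.
  rewrite big_filter; apply: prod_primes_split => //.
  - by rewrite muln_gt0 expn_gt0 (ltnW K1).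
  - by move=> p; rewrite /c => ->.
  - by move=> p hp; rewrite /c leqNgt hp.
have keyc p (b : 'I_N) : p \in s -> key p b < c p.
  rewrite mem_filter mem_iota /= ltnS => /andP[pp pK]; rewrite /key /c.
  have p0 := prime_gt0 pp.
  case: ifP => pP; last first.
    by rewrite ltnS leq_div2r // (leq_trans (ltnW (ltn_pmod _ p0))).
  apply: leq_trans (ltn_pmod _ _) _; first by rewrite expn_gt0 p0.
  rewrite /M expnSr -mulnn mulnA leq_mul //.
  by apply: trunc_logP; [exact: prime_gt1|rewrite muln_gt0 (ltnW K1)].
have [B [_ cB kB]] := pigeonhole _ _ s (fun p (b : 'I_N) => key p b) c finset.setT keyc.
rewrite cardsT card_ord in cB.
pose bad n := T <= \sum_(p <- primes_in P K) high_borrows K p n.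
have cbad : count bad (iota 0 N) * P ^ (2 * T) <= 'C(d + T, T) * (2 * N * K ^ T).
  apply: count_many_high_borrows => //; first by rewrite filter_uniq // iota_uniq.
  by move=> p; rewrite mem_primes_in => /and3P[].
have big : w + K ^ T + count bad (iota 0 N) < #|B|.
  apply: (class_beats_bad N Q 'C(d + T, T) _ (P ^ (2 * T))) => //.
  - by rewrite /Q muln_gt0 !expn_gt0 muln_gt0 expn_gt0 (ltnW K1).
  - by rewrite bin_gt0 leq_addl.
  - by apply: leq_trans wK _; rewrite -{1}[K]expn1 leq_pexp2l // (ltnW K1).
  - exact: leq_expl.
  - by apply: leq_trans cB _; rewrite leq_mul.
have [b0 [b [b0B bB hb ngood]]] := exists_far_good _ _ w _ _ (leq_addr _ _) big.
have hbw : b0 + w <= b by apply: leq_trans hb; rewrite leq_add2l leq_addr.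
exists (b - b0 - w); split.
- by rewrite -subnDA leq_subRL // -addnA.
- by rewrite -subnDA; apply: leq_ltn_trans (leq_subr _ _) (ltn_ord b).
- move=> p pp pP; apply: same_residue_dvdn => //.
  have ps : p \in s by rewrite mem_filter pp mem_iota /= ltnS (leq_trans pP).
  by have := kB p b0 b ps b0B bB; rewrite /key pP.
- move=> p; rewrite mem_primes_in => /and3P[pp pP pK].
  have ps : p \in s by rewrite mem_filter pp mem_iota /= ltnS.
  apply: same_box_near => //; first exact: prime_gt0.
  by have := kB p b0 b ps b0B bB; rewrite /key leqNgt pP.
- by rewrite ltnNge.
Qed.

(** * Bounding u(n, k) for the chosen n *)

Lemma modn_opp M n w : 0 < w -> w <= M -> M %| n + w -> n %% M = M - w.
Proof.
move=> w0 wM /dvdnP[q E]; case: q E => [|q E]; first by lia.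
rewrite mulSn in E; have -> : n = q * M + (M - w) by lia.
by rewrite modnMDl modn_small //; lia.
Qed.

(** Since [n] is just below a multiple of [p^a > 2 K], its residue modulo [p^j]
    is at least [K] for all [j >= a], so borrows occur only at smaller digits. *)
Lemma logn_bin_small K w n k p : prime p -> 0 < w -> w <= K -> k <= K -> k <= n ->
  p ^ (trunc_log p (2 * K)).+1 %| n + w -> logn p 'C(n, k) <= trunc_log p (2 * K).
Proof.
move=> pp w0 wK kK kn; set a := trunc_log p (2 * K).
have : 2 * K < p ^ a.+1 by apply: trunc_log_ltn; apply: prime_gt1.
set M := p ^ a.+1 => MK Mnw.
have nM : k <= n %% M by rewrite (modn_opp M n w) //; lia.
have tail j : a < j -> (n %% p ^ j < k %% p ^ j) = false.
  move=> aj; apply/negbTE; rewrite -leqNgt (leq_trans (leq_mod _ _)) //.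
  exact: leq_trans nM (leq_modn_exp p n _ _ aj).
rewrite logn_bin_borrows //.
apply: (@leq_trans (\sum_(1 <= j < n.+1) (j <= a))).
  apply: leq_sum => j _; case: (leqP j a) => [_|/tail ->] //; exact: leq_b1.
rewrite -big_mkcond /= sum1_count -size_filter -[leqRHS](size_iota 1 a).
apply: uniq_leq_size; first by rewrite filter_uniq // iota_uniq.
by move=> j; rewrite mem_filter mem_index_iota mem_iota add1n !ltnS => /and3P[-> -> _].
Qed.

(** The product [(k + 1) ... (k + m)] is ['C(k + m, m) * m!], and [p > m] is
    coprime to [m!]. *)
Lemma prime_dvd_bin_near p k m z : prime p -> m < p -> 0 < z <= m -> p %| k + z ->
  p %| 'C(k + m, m).
Proof.
move=> pp mp /andP[z0 zm] pz.
have : p %| 'C(k + m, m) * m`!.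
  rewrite bin_ffact ffact_prod.
  have iP : m - z < m by lia.
  rewrite (bigD1 (Ordinal iP)) //= (_ : k + m - (m - z) = k + z) ?dvdn_mulr //; lia.
rewrite Euclid_dvdM // => /orP[//|/(prime_dvd_fact_leq _ _ pp)]; lia.
Qed.

(** If [n] is [y] below a multiple of [p], a borrow in the last digit means that
    [k] is even closer to the next multiple of [p], so that multiple lies in
    [(k, k + m]]. *)
Lemma borrow_near p n k m y : prime p -> m < p -> 0 < y <= m -> p %| n + y ->
  n %% p < k %% p -> p %| 'C(k + m, m).
Proof.
move=> pp mp /andP[y0 ym] pny nk; have p0 := prime_gt0 pp.
rewrite (modn_opp p n y) // in nk; last by lia.
have kp := ltn_pmod k p0.
apply: (@prime_dvd_bin_near p k m (p - k %% p)) => //; first lia.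
have kE := divn_eq k p.
have -> : k + (p - k %% p) = (k %/ p).+1 * p by rewrite mulSn; lia.
exact: dvdn_mull.
Qed.

Lemma logn_bin_large K p n k : prime p -> 0 < k -> k <= K -> k <= n ->
  logn p 'C(n, k) <= (n %% p < k %% p) + high_borrows K p n.
Proof.
move=> pp k0 kK kn; rewrite logn_bin_borrows // big_ltn; last by rewrite ltnS (leq_trans k0).
rewrite expn1 leq_add2l; apply: leq_sum => j _.
case: ltnP => // h; rewrite (leq_trans h) //.
by apply: leq_trans (leq_mod _ _) kK.
Qed.

Lemma prod_if (s : seq nat) (Q : pred nat) F :
  \prod_(p <- s) (if Q p then F p else 1) = \prod_(p <- [seq p <- s | Q p]) F p.
Proof. by rewrite big_filter [RHS]big_mkcond. Qed.

(** The four factors bound, in order: the primes up to [P]; the last digit of the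
    primes in [(P, 2 w]]; the last digit of the primes above [2 w], each of which
    divides ['C(k + 2 w, 2 w)]; and the high borrows. *)
Lemma u_le K w P T n k :
  0 < w -> w <= K -> K <= n -> 0 < k -> k <= K ->
  (forall p, prime p -> p <= P -> p ^ (trunc_log p (2 * K)).+1 %| n + w) ->
  (forall p, p \in primes_in P K -> exists2 y, p %| n + y & 0 < y < 2 * w) ->
  \sum_(p <- primes_in P K) high_borrows K p n < T ->
  u n k <= (2 * K) ^ P * 4 ^ (2 * w) * 'C(K + 2 * w, 2 * w) * K ^ T.
Proof.
move=> w0 wK Kn k0 kK Hs Hl HT.
have K0 : 0 < K by apply: (leq_trans k0 kK).
have kn : k <= n by apply: (leq_trans kK Kn).
pose A p := if p <= P then 2 * K else 1.
pose B p := if p <= 2 * w then p else 1.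
pose C p := if p %| 'C(k + 2 * w, 2 * w) then p else 1.
pose D p := if P < p then K ^ high_borrows K p n else 1.
pose s := [seq p <- index_iota 0 k.+1 | prime p].
have sP p : p \in s = prime p && (p <= k) by rewrite mem_filter mem_index_iota.
have us : uniq s by rewrite filter_uniq // iota_uniq.
have fact : u n k <= \prod_(p <- s) (A p * B p * C p * D p).
  rewrite /u -big_filter -/s big_seq [X in _ <= X]big_seq; apply: leq_prod => p.
  rewrite sP => /andP[pp pk]; have p0 := prime_gt0 pp.
  have A0 : 0 < A p by rewrite /A; case: ifP; rewrite ?muln_gt0.
  have B0 : 0 < B p by rewrite /B; case: ifP.
  have C0 : 0 < C p by rewrite /C; case: ifP.
  have D0 : 0 < D p by rewrite /D; case: ifP; rewrite ?expn_gt0 ?K0.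
  have [pP|pP] := leqP p P.
    apply: (@leq_trans (A p)); last by rewrite -!mulnA leq_pmulr ?muln_gt0 ?B0 ?C0.
    rewrite /A pP; apply: (@leq_trans (p ^ trunc_log p (2 * K))).
      by rewrite leq_pexp2l //; apply: (logn_bin_small K w) => //; exact: Hs.
    by apply: trunc_logP; [exact: prime_gt1|rewrite muln_gt0].
  apply: leq_trans (leq_pexp2l p0 (logn_bin_large K p n k pp k0 kK kn)) _.
  rewrite expnD leq_mul //; last by rewrite /D pP leq_expl // (leq_trans pk).
  case: ltnP => nk; last by rewrite !muln_gt0 A0 B0.
  rewrite expn1; suff : p <= B p * C p.
    by move=> h; apply: leq_trans h _; rewrite -mulnA leq_pmull.
  have [pw|pw] := leqP p (2 * w); first by rewrite /B pw leq_pmulr.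
  have [|y py /andP[y0 yw]] := Hl p; first by rewrite mem_primes_in pp pP (leq_trans pk).
  rewrite /C (@borrow_near p n k (2 * w) y) //; first by rewrite leq_pmull.
  by rewrite y0 ltnW.
apply: leq_trans fact _; rewrite !big_split /=.
rewrite /A /B /C /D !prod_if.
apply: leq_mul; first apply: leq_mul; first apply: leq_mul.
- rewrite big_const_seq count_predT iter_muln_1 leq_pexp2l ?muln_gt0 //.
  rewrite -[leqRHS](size_iota 1 P); apply: uniq_leq_size; first exact: filter_uniq.
  by move=> p; rewrite mem_filter sP mem_iota add1n ltnS => /and3P[-> /prime_gt0 -> _].
- apply: leq_trans (primorial_le _); apply: dvdn_leq.
    by rewrite /primorial prodn_cond_gt0 // => p /prime_gt0.
  apply: prod_primes_dvdn; first exact: filter_uniq.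
  move=> p; rewrite mem_filter sP => /and3P[pw pp _]; split=> //.
  have ps : p \in [seq p <- index_iota 0 (2 * w).+1 | prime p].
    by rewrite mem_filter pp mem_index_iota.
  by rewrite /primorial -big_filter (big_rem _ ps) dvdn_mulr.
- apply: (@leq_trans 'C(k + 2 * w, 2 * w)); last by apply: leq_bin2l; rewrite leq_add2r.
  apply: dvdn_leq; first by rewrite bin_gt0 leq_addl.
  apply: prod_primes_dvdn; first exact: filter_uniq.
  by move=> p; rewrite mem_filter sP => /and3P[? ? _].
rewrite -expn_sum leq_pexp2l //; apply: leq_trans (ltnW HT).
rewrite big_filter /s /primes_in !big_filter_cond.
rewrite [X in _ <= X](big_nat_widenl _ 0) //=.
rewrite [X in _ <= X](big_cat_nat (n := k.+1)) //=.
under [X in _ <= X + _]eq_bigl do rewrite andbT.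
exact: leq_addr.
Qed.

(** Together with [K ^ T <= n] this makes the bound of [u_le] at most
    [K ^ (2 T) <= n ^ 2]. *)
Definition size_budget K w P T :=
  (2 * K) ^ P * 4 ^ (2 * w) * 'C(K + 2 * w, 2 * w) <= K ^ T.

Lemma exists_small_u K w P T :
  0 < w -> w < K -> 0 < P -> P <= K -> 0 < T ->
  class_budget K w P T (size (primes_in P K)) -> size_budget K w P T ->
  exists n, [/\ K ^ T <= n, n < K ^ (2 * T) & forall k, admissible n k -> K < k].
Proof.
move=> w0 wK P0 PK T0 H1 H2.
have [n [h1 h2 h3 h4 h5]] := exists_aligned K w P T w0 wK P0 PK T0 H1.
exists n; split=> // k /and3P[k0 kn nu]; rewrite ltnNge; apply/negP => kK.
move: nu; apply/negP; rewrite -leqNgt.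
have Kn : K <= n.
  by apply: leq_trans h1; rewrite -{1}[K]expn1 leq_pexp2l // (leq_trans P0).
apply: leq_trans (@u_le K w P T n k w0 (ltnW wK) Kn k0 kK h3 h4 h5) _.
by apply: (@leq_trans (K ^ T * K ^ T)); [exact: leq_mul|rewrite -mulnn leq_mul].
Qed.

Local Open Scope ring_scope.

(** * Chebyshev's function on a sequence of scales *)

Lemma ln_prodn (R : realType) (s : seq nat) (P : pred nat) (F : nat -> nat) :
  (forall p, P p -> (0 < F p)%N) ->
  ln (\prod_(p <- s | P p) F p)%N%:R = \sum_(p <- s | P p) ln (F p)%:R :> R.
Proof.
move=> F0; elim: s => [|p s IH]; first by rewrite !big_nil ln1.
rewrite !big_cons; case: ifP => // Pp; rewrite natrM lnM ?IH //.
  by rewrite posrE ltr0n F0.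
by rewrite posrE ltr0n prodn_cond_gt0.
Qed.

Lemma ler_ln_nat (R : realType) (a b : nat) : (0 < a)%N -> (0 < b)%N ->
  (ln a%:R <= ln b%:R :> R) = (a <= b)%N.
Proof. by move=> a0 b0; rewrite ler_ln ?posrE ?ltr0n // ler_nat. Qed.

Definition theta (R : realType) (n : nat) : R := \sum_(0 <= p < n.+1 | prime p) ln p%:R.

Lemma prod_prime_pow_div_fact n :
  (\prod_(0 <= p < n.+1 | prime p) p ^ (n %/ p) <= n`!)%N.
Proof.
apply: dvdn_leq; first exact: fact_gt0.
rewrite -big_filter; apply: prod_prime_powers_dvdn; first by rewrite filter_uniq // iota_uniq.
move=> p; rewrite mem_filter mem_index_iota => /andP[pp /andP[_ pn]]; split=> //.
rewrite pfactor_dvdn ?fact_gt0 // logn_fact // big_ltn ?expn1 ?leq_addr //.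
by apply: leq_trans (prime_gt0 pp) _.
Qed.

Lemma fact_le_expn n : (n`! <= n ^ n)%N.
Proof.
elim: n => // n IH; rewrite factS expnS leq_mul //.
by apply: leq_trans IH _; case: n => // n; rewrite leq_exp2r.
Qed.

(** Legendre's identity: a prime [p] is counted in [theta (n / j)] exactly for
    [j <= n / p], and the product of the [p ^ (n / p)] divides [n!]. *)
Lemma sum_theta_div (R : realType) n :
  \sum_(1 <= j < n.+1) theta R (n %/ j) <= ln n%:R *+ n.
Proof.
have [->|n0] := posnP n; first by rewrite big_geq // mulr0n.
rewrite -lnXn ?ltr0n // -natrX.
have -> : \sum_(1 <= j < n.+1) theta R (n %/ j) =
    \sum_(0 <= p < n.+1 | prime p) ln (p ^ (n %/ p))%:R.
  transitivity (\sum_(1 <= j < n.+1) \sum_(0 <= p < n.+1 | prime p)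
      (if (p * j <= n)%N then ln p%:R else 0 : R)).
    apply: eq_big_nat => j /andP[j0 jn]; rewrite /theta.
    rewrite [RHS](big_cat_nat (n := (n %/ j).+1)) //=; last by rewrite ltnS leq_div.
    rewrite [X in _ + X]big_nat_cond [X in _ + X]big1 ?addr0; last first.
      move=> p /andP[/andP[hp _] _]; by rewrite -leq_divRL // leqNgt hp.
    rewrite big_nat_cond [RHS]big_nat_cond; apply: eq_bigr => p /andP[/andP[_ hp] _].
    by rewrite ltnS leq_divRL // in hp; rewrite hp.
  rewrite exchange_big /=; apply: eq_bigr => p pp.
  have p0 := prime_gt0 pp.
  rewrite natrX lnXn ?ltr0n // -big_mkcond /=.
  rewrite big_const_seq iter_addr_0; congr (_ *+ _).
  rewrite -size_filter -[RHS](size_iota 1); apply/perm_size/uniq_perm.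
  - by rewrite filter_uniq // iota_uniq.
  - exact: iota_uniq.
  move=> j; rewrite mem_filter mem_index_iota mem_iota add1n !ltnS leq_divRL //.
  rewrite mulnC; case: (leqP 1 j) => j1; rewrite ?andbF //=.
  case: leqP => // h; apply: leq_trans h; exact: leq_pmulr.
rewrite -ln_prodn; last by move=> p pp; rewrite expn_gt0 prime_gt0.
rewrite ler_ln_nat; last 2 first.
- by rewrite prodn_cond_gt0 // => p pp; rewrite expn_gt0 prime_gt0.
- by rewrite expn_gt0 n0.
exact: leq_trans (prod_prime_pow_div_fact n) (fact_le_expn n).
Qed.

Lemma ln_le_harmonic (R : realType) J :
  ln J.+1%:R <= \sum_(1 <= j < J.+1) (j%:R : R)^-1.
Proof.
elim: J => [|J IH]; first by rewrite ln1 big_geq.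
rewrite big_nat_recr //=; apply: le_trans (lerD IH (lexx _)).
rewrite -lerBlDl -ln_div ?posrE ?ltr0n //.
have -> : J.+2%:R / J.+1%:R = 1 + J.+1%:R^-1 :> R.
  by rewrite -[J.+2]addn1 natrD mulrDl divff ?mul1r // pnatr_eq0.
by apply: le_ln1Dx; apply: lt_le_trans (_ : 0 <= _); rewrite ?ltrN10 // invr_ge0.
Qed.

(** One half of Chebyshev's theorem that [theta x / x] cannot converge to a limit
    other than [1].
    If [theta x > (1 + e) x] for all [x >= x0], the identity of [sum_theta_div]
    at [n = x0 * J], restricted to [j <= J], gives
    [(1 + e) n (ln J - 1) <= n (ln x0 + ln J)], which fails for large [J]. *)
Lemma theta_liminf (R : realType) (e : R) (x0 : nat) : 0 < e ->
  exists2 x, (x0 <= x)%N & theta R x <= (1 + e) * x%:R.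
Proof.
move=> e0; wlog x0_gt0 : x0 / (0 < x0)%N.
  move=> H; have [//|x hx hth] := H x0.+1; exists x => //; exact: ltnW.
apply: contrapT => Hn.
have big x : (x0 <= x)%N -> (1 + e) * x%:R <= theta R x.
  by move=> hx; rewrite leNgt; apply/negP => h; apply: Hn; exists x => //; apply: ltW.
(* the final contradiction needs e * ln J >= ln x0 + 2 + e *)
pose c := (ln x0%:R + 2 + e) / e.
pose J := (Num.truncn (expR c)).+1.
have Jc : c <= ln J%:R.
  by rewrite -ler_expR lnK ?posrE ?ltr0n // ltW // real_truncnS_gt // num_real.
have J0 : (0 : R) < J%:R by rewrite ltr0n.
pose n := (x0 * J)%N.
have X0 : (1 : R) <= x0%:R by rewrite ler1n.
have lnn : ln n%:R = ln x0%:R + ln J%:R :> R.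
  by rewrite natrM lnM ?posrE ?ltr0n.
have theta_ge0 x : 0 <= theta R x.
  by apply: sumr_ge0 => p pp; rewrite ln_ge0 // ler1n prime_gt0.
have := sum_theta_div R n.
rewrite (big_cat_nat (n := J.+1)) //=; last by rewrite ltnS leq_pmull.
move/(le_trans _) => /(_ (\sum_(1 <= j < J.+1) theta R (n %/ j))).
rewrite lerDl sumr_ge0 // => /(_ isT) H.
have : (1 + e) * (n%:R * ln J%:R - J%:R) <= ln n%:R *+ n.
  apply: le_trans H.
  apply: le_trans (_ : \sum_(1 <= j < J.+1) (1 + e) * (n%:R * j%:R^-1 - 1) <= _).
    rewrite -big_distrr /= ler_pM2l; last by lra.
    rewrite sumrB -big_distrr /= sumr_const_nat subn1 /= lerB //.
    rewrite ler_wpM2l // (le_trans _ (ln_le_harmonic R J)) //.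
    by rewrite ler_ln ?posrE ?ltr0n // ler_nat.
  apply: ler_sum_nat => j /andP[j0 jJ].
  apply: le_trans (big _ _); last by rewrite leq_divRL // leq_mul2l -ltnS jJ orbT.
  rewrite ler_pM2l; last by lra.
  rewrite lerBlDr natr1.
  rewrite ler_pdivrMr ?ltr0n // -natrM ler_nat ltnW // ltn_ceil //.
rewrite lnn -mulr_natl /n !natrM.
have : c * e = ln x0%:R + 2 + e by rewrite divfK // gt_eqF.
have : c * e <= ln J%:R * e by rewrite ler_pM2r.
have := ln_ge0 X0.
set a := ln _; set b := ln J%:R; set X := x0%:R in X0 *; set Y := J%:R in J0 *.
move=> a0 h1 h2 h3.
have : Y * (X * (e * b - a) ) <= Y * (1 + e) by move: h3; lra.
rewrite ler_pM2l // => h4.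
have h5 : e * b - a >= 2 + e by lra.
nra.
Qed.

(** * Choice of the parameters *)

Lemma ln_natM (R : realType) (a b : nat) : (0 < a)%N -> (0 < b)%N ->
  ln (a * b)%N%:R = ln a%:R + ln b%:R :> R.
Proof. by move=> a0 b0; rewrite natrM lnM // posrE ltr0n. Qed.

Lemma ln_natX (R : realType) (a n : nat) : (0 < a)%N ->
  ln (a ^ n)%N%:R = n%:R * ln a%:R :> R.
Proof. by move=> a0; rewrite natrX lnXn ?ltr0n // mulr_natl. Qed.

(** A single term of the binomial expansion of [(1 + x) ^ n], with
    [ln (1 + x) <= x].  At [x = 1 / ln K] it beats the trivial bound, because both
    binomials to be estimated have a lower index much smaller than the upper. *)
Lemma ln_bin_le (R : realType) (n k : nat) (x : R) : (k <= n)%N -> 0 < x ->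
  ln 'C(n, k)%:R <= n%:R * x - k%:R * ln x.
Proof.
move=> kn x0.
have C0 : (0 : R) < 'C(n, k)%:R by rewrite ltr0n bin_gt0.
have : 'C(n, k)%:R * x ^+ k <= (1 + x) ^+ n.
  rewrite exprDn (bigD1 (Ordinal (kn : (k < n.+1)%N))) //= expr1n mul1r mulr_natl.
  rewrite lerDl sumr_ge0 // => i _.
  by rewrite mulrn_wge0 // mulr_ge0 ?exprn_ge0 ?ltW.
have x1 : 0 < 1 + x by rewrite addr_gt0.
rewrite -ler_ln ?posrE ?mulr_gt0 ?exprn_gt0 // lnM ?posrE ?exprn_gt0 //.
rewrite !lnXn // -(mulr_natl (ln x)) -(mulr_natl (ln (1 + x))) => H.
have : n%:R * ln (1 + x) <= n%:R * x.
  by rewrite ler_wpM2l // le_ln1Dx // (lt_trans _ x0) // ltrN10.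
lra.
Qed.

Lemma size_primes_in_theta (R : realType) P K : (0 < P)%N -> (P <= K)%N ->
  (size (primes_in P K))%:R * ln P%:R <= theta R K.
Proof.
move=> P0 PK; rewrite /theta (big_cat_nat (n := P.+1)) //=.
rewrite -[leLHS]add0r lerD //.
  by apply: sumr_ge0 => p pp; rewrite ln_ge0 // ler1n prime_gt0.
rewrite -big_filter -/(primes_in P K).
have -> : (size (primes_in P K))%:R * ln P%:R = \sum_(p <- primes_in P K) (ln P%:R : R).
  by rewrite big_const_seq count_predT iter_addr_0 mulr_natl.
rewrite big_seq [leRHS]big_seq; apply: ler_sum => p; rewrite mem_primes_in => /and3P[_ hp _].
by rewrite ler_ln_nat ?(leq_trans _ hp) // ltnW.
Qed.

(** All asymptotic comparisons needed later, derived from the single assumption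
    that [ln (ln K)] is large compared with [1 / e]. *)
Lemma log_scales (R : realType) (e K : R) (l := ln K) (m := ln l) :
  0 < e <= 1 / 10 -> 40 / e <= m ->
  [/\ 400 <= m, 40 <= e * m, 10 * m <= e * l, 200 * m <= l & 100 * l ^+ 3 <= K].
Proof.
move=> /andP[e0 e1] hm.
have em : 40 <= e * m by rewrite mulrC -ler_pdivrMr.
have m400 : 400 <= m by apply: le_trans hm; rewrite ler_pdivlMr //; lra.
have l0 : 0 < l.
  by rewrite ltNge; apply/negP => h; move: m400; rewrite /m ln0 //; lra.
have K0 : 0 < K.
  by rewrite ltNge; apply/negP => h; move: l0; rewrite /l ln0 // ltxx.
have hl : m ^+ 2 / 2 <= l.
  have := @expR_ge1Dxn R m 1 ltac:(lra).
  by rewrite (_ : 2`! = 2)%N // /m lnK ?posrE // -/m; lra.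
have hK : l ^+ 4 / 24 <= K.
  have := @expR_ge1Dxn R l 3 (ltW l0).
  by rewrite (_ : 4`! = 24)%N // /l lnK ?posrE // -/l; lra.
have m2 : 400 * m <= m ^+ 2 by rewrite expr2 ler_wpM2r //; lra.
have l8 : 200 * m <= l by lra.
split=> //.
  have : e * (m ^+ 2 / 2) <= e * l by rewrite ler_wpM2l // ltW.
  have : 40 * m <= e * m * m by rewrite ler_wpM2r //; lra.
  by rewrite expr2; lra.
apply: le_trans hK; have l3 : 0 <= l ^+ 3 by rewrite exprn_ge0 // ltW.
have : 100 * 24 * l ^+ 3 <= l * l ^+ 3 by rewrite ler_wpM2r //; lra.
lra.
Qed.

(** Logarithmic form of [class_budget], where [p, d, t] stand for [P, d, T] and
    [K = B l ^ 2].  The main terms are [d * m <= (1 + 5/2 e) B l m] on the left and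
    [2 t lp - t l], about [t l >= (1 + 5 e) B l m], on the right; the slack
    [e B l m >= 40 B l] absorbs the rest. *)
Lemma class_budget_estimate (R : realType) (e l m B p d t lp lk lc l2 l4 : R) :
  0 < e -> e <= 1 / 10 -> 400 <= m -> 40 <= e * m -> 10 * m <= e * l ->
  200 * m <= l -> 100 * l <= B ->
  0 <= p -> p <= B -> 0 <= d -> l - 2 * m - 1 <= lp -> d * lp <= (1 + e) * (B * l * l) ->
  (1 + 5 * e) * B * m <= t -> t <= (1 + 6 * e) * B * m ->
  0 <= lk -> lk <= m + 8 -> 0 <= l2 -> l2 <= 1 -> l4 <= 3 ->
  lc <= (d + t) * l^-1 + t * m ->
  l4 + (p * (l2 + 2 * l) + d * lk) + lc + t * l <= 2 * t * lp.
Proof.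
move=> e0 e1 m400 em eml lm lB p0 pB d0 hlp hd t1 t2 lk0 lkm l20 l21 hl4 hlc.
have l0 : 0 < l by lra.
have B0 : 0 < B by lra.
have Bl0 : 0 < B * l by rewrite mulr_gt0.
have Bm0 : 0 < B * m by rewrite mulr_gt0 //; lra.
have Bml0 : 0 < B * m * l by rewrite mulr_gt0.
have eBm0 : 0 < e * (B * m) by rewrite mulr_gt0.
have ee : e * e <= 1 / 10 * e by rewrite ler_wpM2r // ltW.
have dB : d <= (1 + 5 / 2 * e) * (B * l).
  have h1 : d * ((1 - e) * l) <= d * lp by rewrite ler_wpM2l //; lra.
  have h2 : (d * (1 - e)) * l <= ((1 + e) * (B * l)) * l by move: h1 hd; clear; lra.
  rewrite ler_pM2r // in h2.
  have h3 : (1 + e) <= (1 + 5 / 2 * e) * (1 - e) by move: ee e0; clear; lra.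
  have h4 := ler_wpM2r (ltW Bl0) h3.
  have e1' : 0 < 1 - e by lra.
  by rewrite -(ler_pM2r e1'); move: h2 h4; clear; lra.
have g1 : p * (l2 + 2 * l) <= B * (1 + 2 * l) by apply: ler_pM => //; lra.
have g2 : d * lk <= (1 + 5 / 2 * e) * (B * l) * (m + 8) by apply: ler_pM.
have i1 : e * (B * l) <= 1 / 10 * (B * l) by rewrite ler_wpM2r // ltW.
have i2 : e * (B * m) <= 1 / 10 * (B * m) by rewrite ler_wpM2r // ltW.
have i3 : B * (200 * m) <= B * l by rewrite ler_wpM2l // ltW.
have i4 : 1000 * (B * l) <= B * l * l by rewrite mulrC ler_wpM2l // ?ltW //; lra.
have i5 : 1000 * B <= B * l by rewrite mulrC ler_wpM2l // ?ltW //; lra.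
have g3 : (d + t) * l^-1 <= B * l.
  by rewrite ler_pdivrMr //; move: dB t2 i1 i2 i3 i4 Bl0 Bm0; clear; lra.
have t0 : 0 <= t by move: t1 Bm0 eBm0; clear; lra.
have g4 : t * (l - 2 * m - 1) <= t * lp by rewrite ler_wpM2l.
have g5 : (1 + 5 * e) * B * m * ((1 - e) * l) <= t * (l - 5 * m - 2).
  apply: ler_pM => //; first by move: Bm0 eBm0; clear; lra.
    by rewrite mulr_ge0 //; move: e1 l0; clear; lra.
  by move: eml m400; clear; lra.
have g6 : (1 + 7 / 2 * e) * (B * m * l) <= (1 + 5 * e) * (1 - e) * (B * m * l).
  by rewrite ler_wpM2r ?(ltW Bml0) //; move: ee e0; clear; lra.
have g7 : 40 * (B * l) <= e * m * (B * l) by rewrite ler_wpM2r // ltW.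
move: g1 g2 g3 g4 g5 g6 g7 hl4 hlc i1 i5 Bl0 lB B0 lm m400; clear; lra.
Qed.

(** Logarithmic form of [size_budget].  The largest term is the binomial one,
    at most about [B l m / 4], against [t l >= B l m]. *)
Lemma size_budget_estimate (R : realType) (e l m B p w t lc l2 l4 : R) :
  0 < e -> 400 <= m -> 200 * m <= l -> 100 * l <= B ->
  0 <= p -> p <= B -> 0 <= w -> w <= B * l / 8 + 1 -> (1 + 5 * e) * B * m <= t ->
  0 <= l2 -> l2 <= 1 -> 0 <= l4 -> l4 <= 3 ->
  lc <= (B * l * l + 2 * w) * l^-1 + 2 * w * m ->
  p * (l2 + l) + 2 * w * l4 + lc <= t * l.
Proof.
move=> e0 m400 lm lB p0 pB w0 wB t1 l20 l21 l40 hl4 hlc.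
have l0 : 0 < l by lra.
have B0 : 0 < B by lra.
have m0 : 0 <= m by lra.
have Bl0 : 0 < B * l by rewrite mulr_gt0.
have i5 : 1000 * B <= B * l by rewrite mulrC ler_wpM2l // ?ltW //; lra.
have g1 : p * (l2 + l) <= B * (1 + l) by apply: ler_pM => //; lra.
have g2 : w * l4 <= w * 3 by rewrite ler_wpM2l.
have g3 : (B * l * l + 2 * w) * l^-1 <= 2 * (B * l).
  rewrite ler_pdivrMr //; have h : w * 1000 <= w * l by rewrite ler_wpM2l //; lra.
  have i4 : 1000 * (B * l) <= B * l * l by rewrite mulrC ler_wpM2l // ?ltW //; lra.
  by move: wB i4 i5 lB lm m400 Bl0 B0; clear; lra.
have g4 : w * m <= (B * l / 8 + 1) * m by rewrite ler_wpM2r.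
have g5 : (1 + 5 * e) * B * m * l <= t * l by rewrite ler_wpM2r // ltW.
have g6 : 0 <= e * (B * m * l) by rewrite !mulr_ge0 // ltW.
have g7 : 400 * (B * l) <= m * (B * l) by rewrite ler_wpM2r // ltW.
have g8 : B * (200 * m) <= B * l by rewrite ler_wpM2l // ltW.
move: g1 g2 g3 g4 g5 g6 g7 g8 i5 hlc wB lB B0 lm m400 Bl0; clear; lra.
Qed.

(** The scales are [P ~ B], [w ~ B l / 8] and [T ~ (1 + 5 e) B m]. *)
Lemma exists_parameters (R : realType) (e : R) (K : nat)
    (l := ln (K%:R : R)) (m := ln l) (B := K%:R / l ^+ 2) :
  0 < e <= 1 / 10 -> 40 / e <= m -> theta R K <= (1 + e) * K%:R ->
  exists w P T : nat, [/\ [/\ 0 < w, w < K, 0 < P, P <= K & 0 < T]%N,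
    class_budget K w P T (size (primes_in P K)), size_budget K w P T &
    (1 + 5 * e) * B * m <= T%:R <= (1 + 6 * e) * B * m].
Proof.
move=> he hm hth.
have [m400 em eml lm Kl] := log_scales R e K%:R he hm; rewrite -/l -/m in m400 em eml lm Kl.
have [e0 e1] := andP he.
have l0 : 0 < l by lra.
have KE : K%:R = B * l ^+ 2 by rewrite /B divfK // expf_neq0 // gt_eqF.
have Bl : 100 * l <= B.
  rewrite /B ler_pdivlMr ?exprn_gt0 //; apply: le_trans Kl.
  by rewrite le_eqVlt; apply/orP; left; apply/eqP; ring.
have B0 : 0 < B by lra.
have K0 : (0 < K)%N by rewrite -(ltr0n R); nra.
have Klog : ln K%:R = l by [].
have ln_l : ln l = m by [].
have ln2 : ln 2 <= 1 :> R by have := @le_ln1Dx R 1 ltac:(lra).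
have ln4 : ln 4 <= 3 :> R by have := @le_ln1Dx R 3 ltac:(lra); rewrite nat1r.
have lnB : ln (B / 2) = l - 2 * m - ln 2.
  rewrite /B !ln_div ?posrE ?divr_gt0 ?exprn_gt0 ?ltr0n // lnXn // -/l -/m.
  by rewrite mulr2n; lra.
clearbody B m l; clear hm he.
have Bl0 : 0 < B * l by rewrite mulr_gt0.
have tr (x : R) : 0 <= x -> (Num.truncn x)%:R <= x < (Num.truncn x)%:R + 1.
  by move=> x0; rewrite natr1; apply: truncn_itv.
pose P := Num.truncn B.
have [P1 P2] : P%:R <= B /\ B < P%:R + 1 by apply/andP/tr; apply: ltW.
clearbody P.
pose w := (Num.truncn (B * l / 8)).+1.
have [w1 w2] : w%:R <= B * l / 8 + 1 /\ B * l / 8 < w%:R.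
  have /andP[] := tr (B * l / 8) ltac:(lra).
  by rewrite /w -natr1 => ? ?; split; lra.
have w0 : (0 < w)%N by [].
clearbody w.
pose T := (Num.truncn ((1 + 5 * e) * B * m)).+1.
have BM0 : 0 < B * m by rewrite mulr_gt0 //; lra.
have eBm : 1 <= e * (B * m).
  rewrite mulrCA; have : B * 40 <= B * (e * m) by rewrite ler_wpM2l // ltW.
  lra.
have eBm0 : 0 < e * (B * m) by lra.
have [T1 T2] : T%:R <= (1 + 5 * e) * B * m + 1 /\ (1 + 5 * e) * B * m <= T%:R.
  have /andP[] := tr ((1 + 5 * e) * B * m) ltac:(lra).
  by rewrite /T -natr1 => ? ?; split; lra.
have T0 : (0 < T)%N by [].
clearbody T.
have B1 : 1000 * B <= B * l by rewrite mulrC ler_wpM2l // ?ltW //; lra.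
have B2 : 1000 * (B * l) <= B * l * l by rewrite mulrC ler_wpM2l // ?ltW //; lra.
have KE2 : K%:R = B * l * l by rewrite KE expr2 mulrA.
have PK : (P <= K)%N by rewrite -(ler_nat R); lra.
have P0 : (0 < P)%N by rewrite -(ltr0n R); lra.
have wK : (w < K)%N by rewrite -(ltr_nat R); lra.
have lnP : l - 2 * m - 1 <= ln P%:R.
  have : ln (B / 2) <= ln P%:R by rewrite ler_ln ?posrE ?ltr0n //; lra.
  lra.
have il : 0 < l^-1 by rewrite invr_gt0.
have T6 : T%:R <= (1 + 6 * e) * B * m by move: T1 eBm; clear; lra.
exists w, P, T; split=> //; last by rewrite T2 T6.
- pose d := size (primes_in P K).
  have hd := size_primes_in_theta R P K P0 PK; rewrite -/d in hd.
  rewrite /class_budget -/d -(ler_ln_nat R); last 2 first.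
  - by rewrite !muln_gt0 !expn_gt0 muln_gt0 expn_gt0 K0 bin_gt0 leq_addl.
  - by rewrite expn_gt0 P0.
  have Kq : (0 < (2 * K ^ 2) ^ P)%N by rewrite expn_gt0 muln_gt0 expn_gt0 K0.
  have Kr : (0 < (K %/ w).+1 ^ d)%N by rewrite expn_gt0.
  have C0 : (0 < 'C(d + T, T))%N by rewrite bin_gt0 leq_addl.
  rewrite !ln_natM ?muln_gt0 ?Kq ?Kr ?C0 ?expn_gt0 ?K0 //.
  rewrite !ln_natX ?muln_gt0 ?expn_gt0 ?K0 // ln_natM ?expn_gt0 ?K0 // ln_natX // Klog.
  rewrite natrM.
  have hC := ln_bin_le R (d + T) T l^-1 (leq_addl _ _) il.
  rewrite lnV ?posrE // ln_l natrD mulrN opprK in hC.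
  have hR : ln (K %/ w).+1%:R <= m + 8.
    have : ln (K %/ w).+1%:R <= ln (9 * l).
      rewrite ler_ln ?posrE ?ltr0n ?mulr_gt0 // -natr1.
      have : (K %/ w)%:R * w%:R <= K%:R :> R by rewrite -natrM ler_nat leq_divM.
      have q0 : 0 <= (K %/ w)%:R :> R by [].
      set q := _%:R in q0 *; rewrite KE2 => hq.
      have h1 : q * (B * l / 8) <= q * w%:R by rewrite ler_wpM2l // ltW.
      have h2 : q * (B * l) <= (8 * l) * (B * l) by move: h1 hq; clear; lra.
      rewrite ler_pM2r // in h2; lra.
    have : ln 9 <= 8 :> R by have := @le_ln1Dx R 8 ltac:(lra); rewrite nat1r.
    rewrite lnM ?posrE // ln_l; lra.
  apply: (class_budget_estimate R e l m B) => //.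
  - by apply: le_trans hd _; rewrite -KE2.
  - by rewrite ln_ge0 // ler1n.
  - by rewrite ln_ge0 // ler1n.
rewrite /size_budget -(ler_ln_nat R); last 2 first.
- by rewrite !muln_gt0 !expn_gt0 muln_gt0 K0 bin_gt0 leq_addl.
- by rewrite expn_gt0 K0.
have C0 : (0 < 'C(K + 2 * w, 2 * w))%N by rewrite bin_gt0 leq_addl.
rewrite !ln_natM ?muln_gt0 ?C0 ?expn_gt0 ?muln_gt0 ?K0 //.
rewrite !ln_natX ?muln_gt0 ?expn_gt0 ?K0 // ln_natM // Klog.
have hC := ln_bin_le R (K + 2 * w) (2 * w) l^-1 (leq_addl _ _) il.
rewrite lnV ?posrE // ln_l natrD !natrM mulrN opprK KE2 in hC.
rewrite natrM.
apply: (size_budget_estimate R e l m B) => //.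
- by rewrite ln_ge0 // ler1n.
- by rewrite ln_ge0 // ler1n.
Qed.

(** * Lower bounds for f and the limit superior *)

Lemma ln_gt0_arg_gt1 (R : realType) (x : R) : 0 < ln x -> 1 < x.
Proof. by move=> h; rewrite ltNge; apply/negP => /ln_le0; rewrite leNgt h. Qed.

Lemma ln_lower (R : realType) (c x : R) : expR c <= x -> c <= ln x.
Proof.
move=> h; have x0 : 0 < x by apply: lt_le_trans h; exact: expR_gt0.
by rewrite -ler_expR lnK.
Qed.

Lemma lnlnln_large (R : realType) (c : R) :
  exists N : nat, forall n, (N <= n)%N -> c <= ln (ln (ln n%:R)).
Proof.
exists (Num.truncn (expR (expR (expR c)))).+1 => n hn.
do 3!apply: ln_lower; apply: ltW; apply: lt_le_trans (truncnS_gt _) _.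
by rewrite ler_nat.
Qed.

Lemma le_f (R : realType) (n K : nat) : (forall k, admissible n k -> (K < k)%N) ->
  (K%:R%:E <= f R n)%E.
Proof.
move=> H; rewrite /f; case: pselect => [ex|_]; last exact: leey.
by case: ex_minnP => k /H /ltnW hk _; rewrite lee_fin ler_nat.
Qed.

(** With [y = ln n] between [t l] and [2 t l], the iterated logarithms are
    [ln y <= l] and [ln (ln y) >= (1 - e) m], so [y ln y / ln (ln y)] is at most
    [2 (1 + 6 e) / (1 - e)] times [B l ^ 2 = K].  Bounding the logarithms
    separately avoids any appeal to monotonicity in [y]. *)
Lemma scale_of_n_estimate (R : realType) (e l m B t y : R) (z := ln y) (v := ln z) :
  0 < e -> e <= 1 / 10 -> 400 <= m -> 40 <= e * m -> 10 * m <= e * l ->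
  100 * l <= B -> m = ln l -> ln (B * l ^+ 2) = l ->
  (1 + 5 * e) * B * m <= t -> t <= (1 + 6 * e) * B * m ->
  t * l <= y -> y <= 2 * t * l ->
  [/\ 0 < y, 0 < z, 0 < v & (1 / 2 - 4 * e) * y * (z / v) <= B * l ^+ 2].
Proof.
move=> e0 e1 m400 em eml lB mE lE t1 t2 y1 y2.
have em10 : e * m <= 1 / 10 * m by rewrite ler_wpM2r //; lra.
have el10 : e * l <= 1 / 10 * l.
  by rewrite ler_wpM2r // -(pmulr_rge0 _ e0); move: eml m400; clear; lra.
have lm : 100 * m <= l by move: eml el10; clear; lra.
have l0 : 0 < l by lra.
have B0 : 0 < B by lra.
have Bl0 : 0 < B * l by rewrite mulr_gt0.
have Bm0 : 0 < B * m by rewrite mulr_gt0 //; lra.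
have eBm0 : 0 < e * (B * m) by rewrite mulr_gt0.
have Bl20 : 0 < B * l ^+ 2 by rewrite mulr_gt0 // exprn_gt0.
have ty : B * m * l <= y.
  apply: le_trans y1; rewrite ler_wpM2r ?(ltW l0) //.
  by move: t1 Bm0 eBm0; clear; lra.
have BlB : B * l <= B * m * l by rewrite ler_wpM2r ?(ltW l0) // ler_peMr // ?ltW //; lra.
have y0 : 0 < y by lra.
have yU : y <= 2 * (1 + 6 * e) * (B * m * l).
  apply: le_trans y2 _.
  have : t * l <= (1 + 6 * e) * B * m * l by rewrite ler_wpM2r ?(ltW l0).
  by clear; lra.
have yK : y <= B * l ^+ 2.
  have h1 : e * (B * m * l) <= 1 / 10 * (B * m * l).
    by rewrite ler_wpM2r // mulr_ge0 // ltW.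
  have h2 : (B * l) * (100 * m) <= (B * l) * l by rewrite ler_wpM2l // ltW.
  have h3 : 0 < B * m * l by rewrite mulr_gt0.
  by move: yU h1 h2 h3; rewrite expr2; clear; lra.
have zl : z <= l by rewrite -lE /z ler_ln ?posrE.
have zL : l - m <= z.
  have -> : l - m = ln (B * l).
    have <- : B * l ^+ 2 / l = B * l by rewrite expr2 mulrA mulfK // gt_eqF.
    by rewrite ln_div ?posrE // lE -mE.
  by rewrite ler_ln ?posrE //; lra.
have ln2 : ln 2 <= 1 :> R by have := @le_ln1Dx R 1 ltac:(lra).
have z0 : 0 < z by lra.
have vL : (1 - e) * m <= v.
  have : ln (l / 2) <= v by rewrite /v ler_ln ?posrE //; lra.
  by rewrite ln_div ?posrE // -mE; lra.
have v0 : 0 < v by lra.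
split=> //.
rewrite mulrA ler_pdivrMr //.
have g1 : y * z <= 2 * (1 + 6 * e) * (B * m * l) * l.
  by apply: ler_pM => //; rewrite ltW.
have g2 : (1 / 2 - 4 * e) * (y * z) <= (1 / 2 - 4 * e) * (2 * (1 + 6 * e) * (B * m * l) * l).
  by rewrite ler_wpM2l //; lra.
have g3 : B * l ^+ 2 * ((1 - e) * m) <= B * l ^+ 2 * v by rewrite ler_wpM2l // ltW.
have m0 : 0 < m by lra.
have g4 : 0 <= e * (B * m * l * l) by rewrite !mulr_ge0 // ltW.
have g5 : 0 <= e * (e * (B * m * l * l)) by rewrite mulr_ge0 // ltW.
by move: g2 g3 g4 g5; rewrite expr2; clear; lra.
Qed.

(** The quantitative core: [f n >= K] for an [n] with
    [ln n <= 2 T ln K]. *)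
Lemma f_large (R : realType) (d : R) (N : nat) : 0 < d ->
  exists2 n : nat, (N <= n)%N &
    (((1 / 2 - d) * ln n%:R * (ln (ln n%:R) / ln (ln (ln n%:R))))%:E <= f R n)%E.
Proof.
move=> d0.
(* the loss in scale_of_n_estimate is 4 e *)
pose e := Order.min (d / 4) (1 / 10).
have e0 : 0 < e by rewrite /e lt_min; apply/andP; split; lra.
have e1 : e <= 1 / 10 by rewrite /e ge_min lexx orbT.
have ed : 4 * e <= d.
  have : e <= d / 4 by rewrite /e ge_min lexx.
  lra.
have e01 : 0 < e <= 1 / 10 by rewrite e0.
clearbody e.
pose K0 := (Num.truncn (expR (expR (40 / e)))).+1.
have [K hK hth] := theta_liminf R e (maxn N K0) e0.
move: hK; rewrite geq_max => /andP[NK hK].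
have hm : 40 / e <= ln (ln (K%:R : R)).
  do 2!apply: ln_lower; apply: ltW; apply: lt_le_trans (truncnS_gt _) _.
  by rewrite ler_nat.
have [m400 em eml lm Kl] := log_scales R e K%:R e01 hm.
have [w [P [T [[w0 wK P0 PK T0] hc hb /andP[T1 T2]]]]] :=
  exists_parameters R e K e01 hm hth.
have [n [n1 n2 hn]] := exists_small_u K w P T w0 wK P0 PK T0 hc hb.
have Kp : (0 < K)%N by apply: leq_trans P0 PK.
have Kn : (K <= n)%N by apply: leq_trans n1; rewrite -{1}[K]expn1 leq_pexp2l.
exists n; first exact: leq_trans NK Kn.
apply: le_trans (le_f R n K hn); rewrite lee_fin.
set l := ln K%:R in hm m400 em eml lm Kl T1 T2 *.
set m := ln l in hm m400 em eml lm Kl T1 T2 *.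
set B := K%:R / l ^+ 2 in T1 T2 *.
have l0 : 0 < l by move: lm m400; clear; lra.
have KE : B * l ^+ 2 = K%:R by rewrite /B divfK // expf_neq0 // gt_eqF.
have lB : 100 * l <= B.
  rewrite /B ler_pdivlMr ?exprn_gt0 //; apply: le_trans Kl.
  by rewrite le_eqVlt; apply/orP; left; apply/eqP; ring.
have n0 : (0 < n)%N by apply: leq_trans Kn.
have y1 : T%:R * l <= ln n%:R.
  by rewrite /l -ln_natX // ler_ln_nat // expn_gt0 Kp.
have y2 : ln n%:R <= 2 * T%:R * l.
  by rewrite -natrM /l -ln_natX // ler_ln_nat ?(ltnW n2) // expn_gt0 Kp.
have lE : ln (B * l ^+ 2) = l by rewrite KE.
have [h1 h2 h3 h4] := scale_of_n_estimate R e l m B T%:R (ln n%:R) e0 e1 m400 em eml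
  lB erefl lE T1 T2 y1 y2.
rewrite -KE; apply: le_trans h4; apply: ler_wpM2r.
  by rewrite divr_ge0 // ltW.
by apply: ler_wpM2r; [rewrite ltW|lra].
Qed.

Lemma limn_esup_ge (R : realType) (g : nat -> \bar R) (a : \bar R) :
  (forall N : nat, exists2 n, (N <= n)%N & (a <= g n)%E) -> (a <= limn_esup g)%E.
Proof.
move=> H; rewrite /limn_esup /limf_esup; apply: le_ereal_inf_tmp => _ [V [N _ hN] <-].
have [n Nn an] := H N; apply: le_ereal_sup_tmp; exists (g n) => //.
by exists n => //; apply: hN.
Qed.

(** The factor [ln (ln n) / ln (ln (ln n))] tends to infinity, since
    [l2 >= l3 ^ 2 / 2] for [l3 = ln l2]. *)
Lemma f_over_log_unbounded (R : realType) (C : R) (N : nat) : 0 < C ->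
  exists n : nat, [/\ (N <= n)%N, 0 < ln (n%:R : R) & ((C * ln (n%:R : R))%:E < f R n)%E].
Proof.
move=> C0; have [M hM] := lnlnln_large R (8 * C + 1).
have [n] := f_large R (1 / 4) (maxn N M) ltac:(lra).
rewrite geq_max => /andP[Nn Mn] hf; have := hM n Mn.
set L := ln n%:R in hf *; set l2 := ln L in hf *; set l3 := ln l2 in hf * => h3.
have l30 : 0 < l3 by lra.
have l21 := ln_gt0_arg_gt1 R l2 l30.
have L1 : 1 < L by apply: ln_gt0_arg_gt1; apply: lt_trans l21.
exists n; split=> //; first exact: lt_trans L1.
apply: lt_le_trans hf; rewrite lte_fin -/L.
have hl : l3 ^+ 2 / 2 <= l2.
  have := @expR_ge1Dxn R l3 1 (ltW l30).
  by rewrite (_ : 2`! = 2)%N // /l3 lnK ?posrE ?(lt_trans _ l21) //; lra.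
have q4 : 4 * C < l2 / l3.
  rewrite ltr_pdivlMr //.
  have : (8 * C + 1) * l3 <= l3 * l3 by rewrite ler_pM2r.
  by move: hl; rewrite expr2; lra.
have L0 : 0 < L by lra.
have : L * (4 * C) < L * (l2 / l3) by rewrite ltr_pM2l.
by set q := l2 / l3; lra.
Qed.

Local Open Scope classical_set_scope.
Local Open Scope ring_scope.

Theorem theorem1p2 (R : realType) :
  [/\ ((1 / 2 : R)%:E <=
        limn_esup (fun n : nat =>
          f R n / (ln (n%:R : R))%:E *
          (ln (ln (ln (n%:R : R))) / ln (ln (n%:R : R)))%:E))%E,
      (exists (n_ : nat -> nat) (e : nat -> R),
        [/\ n_ @ \oo --> \oo,
            e @ \oo --> (0 : R) &
            \forall j \near \oo,
              (((1 / 2 - e j) * ln ((n_ j)%:R : R) *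
                 (ln (ln ((n_ j)%:R : R)) / ln (ln (ln ((n_ j)%:R : R)))))%:E
               <= f R (n_ j))%E]),
      (limn_esup (fun n : nat => f R n / (ln (n%:R : R))%:E) = +oo)%E &
      (forall C : R, 0 < C -> forall N : nat, exists n : nat,
        (N <= n)%N /\ ((C * ln (n%:R : R))%:E < f R n)%E)].
Proof.
split.
- apply/lee_subgt0Pr => d d0; rewrite -EFinB; apply: limn_esup_ge => N.
  have [M hM] := lnlnln_large R 1.
  have [n] := f_large R d (maxn N M) d0.
  rewrite geq_max => /andP[Nn Mn] hf; exists n => //; have := hM n Mn.
  set L := ln n%:R in hf *; set l2 := ln L in hf *; set l3 := ln l2 in hf * => h3.
  have l30 : 0 < l3 by lra.
  have l21 := ln_gt0_arg_gt1 R l2 l30.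
  have L1 : 1 < L by apply: ln_gt0_arg_gt1; apply: lt_trans l21.
  have L0 : 0 < L by lra.
  have l20 : 0 < l2 by lra.
  rewrite inver gt_eqF //.
  have q0 : (0 <= (l3 / l2)%:E)%E by rewrite lee_fin divr_ge0 // ltW.
  have L'0 : (0 <= (L^-1)%:E)%E by rewrite lee_fin invr_ge0 ltW.
  apply: le_trans (lee_wpmul2r q0 (lee_wpmul2r L'0 hf)).
  rewrite -!EFinM lee_fin le_eqVlt; apply/orP; left; apply/eqP.
  by field; rewrite !gt_eqF.
- have H j : exists n : nat, (j <= n)%N /\
      (((1 / 2 - harmonic j) * ln n%:R * (ln (ln n%:R) / ln (ln (ln n%:R))))%:E <= f R n)%E.
    have [|n jn hn] := f_large R (harmonic j) j; first by rewrite /harmonic invr_gt0.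
    by exists n.
  have [n_ hn_] := choice H.
  exists n_, harmonic; split.
  + apply/cvgnyPge => A; exists A => // j /= Aj.
    by apply: leq_trans Aj _; case: (hn_ j).
  + exact: cvg_harmonic.
  + by apply: nearW => j; case: (hn_ j).
- apply: eq_infty => r; apply: limn_esup_ge => N.
  have C0 : 0 < `|r| + 1 by rewrite ltr_wpDl.
  have [n [Nn L0 /ltW hf]] := f_over_log_unbounded R (`|r| + 1) N C0.
  exists n => //; rewrite inver gt_eqF //.
  have L'0 : (0 <= ((ln n%:R)^-1 : R)%:E)%E by rewrite lee_fin invr_ge0 ltW.
  apply: le_trans (lee_wpmul2r L'0 hf).
  rewrite -EFinM lee_fin mulfK ?gt_eqF //.
  by have := ler_norm r; lra.
- move=> C C0 N; have [n [Nn _ hf]] := f_over_log_unbounded R C N C0.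
  by exists n.
Qed.
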